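(* Let $X_t=e^{Y_t}$ be an exponential Lévy process with characteristic exponent $\phi$, let $f(x)=x^\beta$ and $g(X_t,t)=e^{-ct}f(X_t)=e^{-ct}X_t^\beta$ with $c>0$, and assume $\phi_1(\beta)<0$ and $\phi_2(2\beta)<0$, where $\phi_1(\cdot):=\phi(\cdot)-c$ and $\phi_2(\cdot):=\phi(\cdot)-2c$. For $m>0$ let $$w(m):=\frac{\left(\mathbb{E}\int_m^\infty g(X_s,s)\,ds\right)^2}{\inf\limits_{Q\in\mathcal{M}(\mathbb{R}^+):\,\mathbb{E}^Q[N]=m}\operatorname{Var}\left(\int_0^N\frac{g(X_s,s)}{Q(N>s)}\,ds\right)-\operatorname{Var}\left(\int_0^m g(X_s,s)\,ds\right)}.$$ Then $$w(m)=\begin{cases}\dfrac{\Delta_1}{\Delta_2-\Delta_4}, & 0<m\le\dfrac{2}{|\phi_2(2\beta)|},\\[2mm] \dfrac{\Delta_1}{\Delta_3-\Delta_4}, & m>\dfrac{2}{|\phi_2(2\beta)|},\end{cases}$$ where $$\Delta_1:=\frac{e^{-2|\phi_1(\beta)|m}}{|\phi_1(\beta)|^2},\qquad \Delta_2:=\frac{8}{m}\frac{1}{|\phi_1(\beta)||\phi_2(2\beta)|^2}-\frac{1}{|\phi_1(\beta)|^2},$$ $$\Delta_3:=\frac{2+2e^{-m|\phi_2(2\beta)|+2}}{|\phi_1(\beta)||\phi_2(2\beta)|}-\frac{1}{|\phi_1(\beta)|^2},$$ $$\Delta_4:=\frac{2(1-e^{-m|\phi_2(2\beta)|})}{|\p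hi_1(\beta)||\phi_2(2\beta)|}+\frac{2e^{-m|\phi_2(2\beta)|}-2e^{-m|\phi_1(\beta)|}}{|\phi_1(\beta)|\,(|\phi_2(2\beta)|-|\phi_1(\beta)|)}-\left(\frac{1-e^{-m|\phi_1(\beta)|}}{|\phi_1(\beta)|}\right)^2.$$
   Context: $Y=\{Y_t:t\ge0\}$ is a Lévy process and $\phi$ denotes its characteristic exponent in the sense $\mathbb{E}[e^{bY_t}]=e^{t\phi(b)}$; $\beta$ is fixed. $\mathcal{M}(\mathbb{R}^+)$ denotes the set of probability distributions $Q$ of a random variable $N$, independent of $X$, with $Q(N\ge0)=1$ and $Q(N>s)>0$ for all $s\in[0,\infty)$; $\mathbb{E}^Q[N]$ is the mean of $N$ under $Q$. Throughout, the expectations and variances of all estimators are assumed to be finite and well-defined.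
   Formalization: The formal theorem adds the condition |φ_2(2β)| ≠ |φ_1(β)|, since otherwise the formula for Δ_4 divides zero by zero (e.g. Brownian motion with φ(b)=b²/2, β≠0, c=3β²/2). *)

(* Defs.v *)
From HB Require Import structures.
From mathcomp Require Import all_boot all_order all_algebra.
From mathcomp Require Import all_classical all_reals all_analysis.

Set Implicit Arguments.
Unset Strict Implicit.
Unset Printing Implicit Defensive.

Import Order.TTheory GRing.Theory Num.Theory.
Import numFieldNormedType.Exports.

Local Open Scope classical_set_scope.
Local Open Scope ring_scope.

(* Taking some of the [B i] equal to [setT] gives the product rule for every
   subfamily. *)
Definition mutually_independent d (T : measurableType d) (R : realType)
    (P : probability T R) (n : nat) (X : 'I_n -> T -> R) : Prop :=
  forall B : 'I_n -> set R, (forall i, measurable (B i)) ->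
    P (\bigcap_(i in [set: 'I_n]) (X i @^-1` B i)) =
    (\prod_(i < n) P (X i @^-1` B i))%E.

Definition cadlag (R : realType) (y : R -> R) : Prop :=
  (forall t, 0 <= t -> y x @[x --> t^'+] --> y t) /\
  (forall t, 0 < t -> cvg (y x @[x --> t^'-])).

(* Processes are indexed by all of [R] for convenience; only the times [t >= 0]
   are constrained, here and below. *)
Record levy_process d (T : measurableType d) (R : realType)
    (P : probability T R) (Y : R -> {RV P >-> R}) : Prop := LevyProcess {
  levy_start : {ae P, forall w, Y 0 w = 0};
  levy_independent_increments : forall (n : nat) (t : nat -> R),
    0 <= t 0%N -> (forall i, t i <= t i.+1) ->
    mutually_independent P (fun (i : 'I_n) w => Y (t i.+1) w - Y (t i) w);
  levy_stationary_increments : forall s t : R, 0 <= s -> s <= t ->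
    forall B : set R, measurable B ->
    P ((fun w => Y t w - Y s w) @^-1` B) = P (Y (t - s) @^-1` B);
  levy_cadlag : {ae P, forall w, cadlag (fun t => Y t w)}
}.

(* [phi b = +oo] exactly when [exp (b Y_t)] is not integrable (for t > 0). *)
Definition characteristic_exponent d (T : measurableType d) (R : realType)
    (P : probability T R) (Y : R -> {RV P >-> R}) (phi : R -> \bar R) : Prop :=
  forall b t : R, 0 <= t ->
    ('E_P[fun w => expR (b * Y t w)] = expeR (t%:E * phi b))%E.

Definition discounted_power (R : realType) (c beta x t : R) : R :=
  expR (- (c * t)) * x `^ beta.

Definition truncation_laws (R : realType) :
    set (probability (measurableTypeR R) R) :=
  [set Q : probability (measurableTypeR R) R |
     Q `[0, +oo[%classic = 1%E /\
     forall s : R, 0 <= s -> (0 < Q `]s, +oo[%classic)%E].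

(* [G s w] stands for g(X_s(w), s).  A divergent path integral is read as 0; for
   nonnegative [G] whose integral over [0, +oo[ has finite mean this happens
   only on a null set, here and below. *)
Definition truncated_integral (T : Type) (R : realType) (G : R -> T -> R)
    (m : R) (w : T) : R :=
  \int[lebesgue_measure]_(s in `[0, m]) G s w.

(* On the product space, the second coordinate [wn.2] is the random time N,
   of law [Q] and independent of everything defined on [T]. *)
Definition randomized_integral (T : Type) (R : realType) (G : R -> T -> R)
    (Q : probability (measurableTypeR R) R) (wn : T * measurableTypeR R) : R :=
  \int[lebesgue_measure]_(s in `[0, wn.2])
    (G s wn.1 / fine (Q `]s, +oo[%classic)).

(* The variances are extended-real valued, so a law [Q] whose estimator has
   infinite variance does not affect the infimum. *)
Definition bias_variance_ratio d (T : measurableType d) (R : realType)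
    (P : probability T R) (G : R -> T -> R) (m : R) : \bar R :=
  (('E_P[fun w => (\int[lebesgue_measure]_(s in `[m, +oo[) G s w)%R]) ^+ 2 /
   (ereal_inf [set 'V_(P \x Q)[randomized_integral G Q] |
       Q in [set Q : probability (measurableTypeR R) R |
               truncation_laws Q /\ 'E_Q[fun x => x] = m%:E]]
    - 'V_P[truncated_integral G m]))%E.

(* Main.v *)
Require Import Defs.
From HB Require Import structures.
From mathcomp Require Import all_boot all_order all_algebra.
From mathcomp Require Import all_classical all_reals all_analysis.
From mathcomp Require Import measurable_realfun.
From mathcomp Require Import ring lra.

Set Implicit Arguments.
Unset Strict Implicit.
Unset Printing Implicit Defensive.

Import Order.TTheory GRing.Theory Num.Theory.
Import numFieldNormedType.Exports.

Local Open Scope classical_set_scope.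
Local Open Scope ring_scope.

(* By independence and stationarity of the increments,
   E[g(X_s, s) g(X_t, t)] = exp (- a2 s - a1 (t - s)) for s <= t, where
   a1 = |phi1(beta)| and a2 = |phi2(2 beta)|.  Tonelli then turns the second
   moment of the randomized estimator into
   2 / a1 * int_0^oo exp (- a2 s) / Q(N > s) ds, and a convex minimization over
   the survival function under the constraint int_0^oo Q(N > s) ds = m gives
   the optimal law, that of max(0, E + x0) with E exponential of rate a2 / 2.
   Its shift x0 is positive exactly when m > 2 / a2, whence the two cases.
   As the paths are only almost surely cadlag, the path integrals need not be
   measurable; they agree off a null set with integrals of a jointly measurable
   version of g. *)

(** A law may give its estimator an infinite variance, so moments are kept as integrals of
    nonnegative functions; a term to be subtracted is first moved to the other side, and only finite
    quantities are cancelled. The constrained minimization is a Lagrangian argument. The factor exp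
    (- a2 x0) is the multiplier of the mean constraint, and minimizing the integrand separately at
    each time is enough because the pointwise minimizers decrease in time, hence form a survival
    function; the prescribed mean then fixes x0. The quotient has the stated real value only if its
    denominator is nonzero. Its positivity comes from a chain: Var (int_0^m g) is at most Var
    (int_0^oo g), which is strictly below the minimal variance. The first inequality rests on a2 <=
    2 a1, itself the nonnegativity of Var (g(X_1, 1)). *)

Section null_sets.
Local Open Scope ereal_scope.
Context d (T : measurableType d) (R : realType).
Variable mu : {measure set T -> \bar R}.

Import HBNNSimple.

(* Works for nonmeasurable [f] and [g]: the simple functions below [f] can be
   cut off on [A] without changing their integrals. *)
Lemma ge0_integral_eq_off_null (A : set T) (f g : T -> \bar R) :
  measurable A -> mu A = 0 -> (forall x, 0 <= f x) -> (forall x, 0 <= g x) ->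
  (forall x, ~ A x -> f x = g x) -> \int[mu]_x f x = \int[mu]_x g x.
Proof.
move=> mA A0.
wlog suff le_int : f g / (forall x, 0 <= f x) -> (forall x, 0 <= g x) ->
    (forall x, ~ A x -> f x = g x) -> \int[mu]_x f x <= \int[mu]_x g x.
  move=> f0 g0 fg; apply/eqP; rewrite eq_le !le_int// => x Ax.
  by rewrite fg.
move=> f0 g0 fg; rewrite !ge0_integralTE//.
apply: ge_ereal_sup => _ [h hf <-].
have mAC : measurable (~` A) by exact: measurableC.
have projE x : proj_nnsfun h mAC x = (h \_ (~` A)) x by rewrite mrestrict.
apply: ereal_sup_ubound; exists (proj_nnsfun h mAC).
  move=> x; rewrite projE patchE; case: ifPn => [/set_mem Ax|_] //.
  by rewrite -fg.
have sintegralT (k : {nnsfun T >-> R}) : sintegral mu k = \int[mu]_x (k x)%:E.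
  by rewrite integral_nnsfun// patch_setT.
rewrite !sintegralT.
apply: ge0_ae_eq_integral => //.
- exact/measurable_EFinP.
- exact/measurable_EFinP.
- by move=> x _; rewrite lee_fin.
- by move=> x _; rewrite lee_fin.
exists A; split => // x hx; apply: contrapT => Ax; apply: hx => _.
by rewrite projE patchE mem_set.
Qed.

End null_sets.

(** * Squares of path integrals as integrals over ordered pairs of times *)

Section second_moment.
Local Open Scope ereal_scope.
Context (R : realType).
Let U := measurableTypeR R.
Let lam : {sigma_finite_measure set U -> \bar R} := @lebesgue_measure R.

Lemma measurable_ltr_if d (T : measurableType d) (a b : T -> R)
    (f : T -> \bar R) : measurable_fun setT a -> measurable_fun setT b ->
  measurable_fun setT f ->
  measurable_fun setT (fun x => if (a x < b x)%R then f x else 0).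
Proof.
move=> ma mb mf; apply: measurable_fun_ifT => //.
exact: measurable_fun_ltr.
Qed.

(** The square is an integral over the plane. The diagonal is null, and Tonelli exchanges the half
    [t < s] with the half [s < t]. *)
Lemma ge0_integral_square (f : U -> \bar R) :
  measurable_fun setT f -> (forall x, 0 <= f x) ->
  (\int[lam]_s f s) * (\int[lam]_s f s) =
  2%:E * \int[lam]_s \int[lam]_t (if (s < t)%R then f s * f t else 0).
Proof.
move=> mf f0.
pose D (z : U * U) := if (z.1 < z.2)%R then f z.1 * f z.2 else 0.
have D0 z : 0 <= D z by rewrite /D; case: ifP => // _; exact: mule_ge0.
have mD : measurable_fun setT D.
  apply: measurable_ltr_if; [exact: measurable_fst|exact: measurable_snd|].
  by apply: emeasurable_funM; apply: measurableT_comp.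
rewrite -ge0_integralZr//; last exact: integral_ge0.
transitivity (\int[lam]_s \int[lam]_t (D (s, t) + D (t, s))).
  apply: eq_integral => s _; rewrite -ge0_integralZl//.
  apply: (@ge0_integral_eq_off_null _ _ _ _ [set s]) => //.
  - exact: lebesgue_measure_set1.
  - by move=> t; exact: mule_ge0.
  - by move=> t; exact: adde_ge0.
  move=> t /eqP ts; rewrite /D/=.
  have [st|st|/esym/eqP] := ltgtP s t; last by rewrite (negbTE ts).
  - by rewrite adde0.
  - by rewrite add0e muleC.
transitivity (\int[lam]_s (\int[lam]_t D (s, t) + \int[lam]_t D (t, s))).
  apply: eq_integral => s _; rewrite ge0_integralD//.
  - by apply: measurableT_comp => //; exact: pair1_measurable.
  - by apply: measurableT_comp => //; exact: pair2_measurable.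
rewrite ge0_integralD//; last 4 first.
- by move=> s _; exact: integral_ge0.
- exact: (measurable_fun_fubini_tonelli_F D).
- by move=> s _; exact: integral_ge0.
- exact: (measurable_fun_fubini_tonelli_G D).
by rewrite -fubini_tonelli// -mule2n mule_natl.
Qed.

Context d (T : measurableType d).
Variable mu : {sigma_finite_measure set T -> \bar R}.

(** Ordering the times before taking the expectation leaves only correlations at [s < t], the form
    in which independent increments give them. Tonelli is used twice, to move the integral over [w]
    past [s] and then past [t]. *)
Lemma integral_path_square (h : T * U -> \bar R) :
  measurable_fun setT h -> (forall x, 0 <= h x) ->
  \int[mu]_w ((\int[lam]_s h (w, s)) * (\int[lam]_s h (w, s))) =
  2%:E * \int[lam]_s \int[lam]_t
    (if (s < t)%R then \int[mu]_w (h (w, s) * h (w, t)) else 0).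
Proof.
move=> mh h0.
pose D (x : T * U * U) :=
  if (x.1.2 < x.2)%R then h x.1 * h (x.1.1, x.2) else 0.
pose F (y : T * U) := \int[lam]_t D (y, t).
have D0 z : 0 <= D z by rewrite /D; case: ifP => // _; exact: mule_ge0.
have F0 z : 0 <= F z by exact: integral_ge0.
have m12 : measurable_fun setT (fun x : T * U * U => x.1.2).
  by apply: (measurableT_comp measurable_snd); exact: measurable_fst.
have m11 : measurable_fun setT (fun x : T * U * U => x.1.1).
  by apply: (measurableT_comp measurable_fst); exact: measurable_fst.
have mD : measurable_fun setT D.
  apply: (measurable_ltr_if m12 measurable_snd).
  apply: emeasurable_funM; first exact: (measurableT_comp mh measurable_fst).
  apply: (measurableT_comp mh).
  by apply: measurable_fun_pair => //; exact: measurable_snd.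
have mF : measurable_fun setT F.
  exact: (@measurable_fun_fubini_tonelli_F _ _ _ _ _ lam D).
transitivity (\int[mu]_w (2%:E * \int[lam]_s F (w, s))).
  apply: eq_integral => w _; rewrite ge0_integral_square//.
  by apply: measurableT_comp => //; exact: pair1_measurable.
rewrite ge0_integralZl//; last 2 first.
- exact: (@measurable_fun_fubini_tonelli_F _ _ _ _ _ lam F).
- by move=> w _; exact: integral_ge0.
congr (_ * _).
rewrite (@fubini_tonelli _ _ _ _ _ mu lam F)//.
apply: eq_integral => s _.
rewrite /F (@fubini_tonelli _ _ _ _ _ mu lam (fun x => D ((x.1, s), x.2)))//.
  apply: eq_integral => t _; rewrite /D/=.
  by case: ifP => // _; rewrite integral0.
apply: measurableT_comp => //; apply: measurable_fun_pair => //.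
by apply: measurable_fun_pair => //; exact: measurable_fst.
Qed.

End second_moment.

(** * Mean and variance of a variable that is measurable only off a null set *)

Section moments_of_path_integrals.
Local Open Scope ereal_scope.
Context d (T : measurableType d) (R : realType) (P : probability T R).

(* Expanding [(Z - r)^2 + 2 r Z = Z^2 + r^2] keeps every term nonnegative, so
   the variance may be infinite. *)
Lemma expectation_variance_fine (A : set T) (I : T -> \bar R) (Z : T -> R)
    (r : R) :
  measurable A -> P A = 0 -> measurable_fun setT I -> (forall w, 0 <= I w) ->
  (forall w, (0 <= Z w)%R) -> (forall w, ~ A w -> Z w = fine (I w)) ->
  \int[P]_w I w = r%:E ->
  'E_P[Z] = r%:E /\ 'V_P[Z] = \int[P]_w (I w * I w) - (r ^+ 2)%:E.
Proof.
move=> mA A0 mI I0 Z0 ZI Ir.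
have r0 : (0 <= r)%R by rewrite -lee_fin -Ir integral_ge0.
have int_I : P.-integrable setT I.
  apply/integrableP; split => //.
  by under eq_integral do rewrite gee0_abs//; rewrite Ir ltry.
(* Off [B] the value of [I] is finite, so [fine] loses nothing there. *)
have [B [mB B0 BI]] := integrable_ae measurableT int_I.
have mAB : measurable (A `|` B) by exact: measurableU.
have AB0 : P (A `|` B) = 0 by rewrite measureU0.
have ZI' w : ~ (A `|` B) w -> (Z w)%:E = I w.
  move=> /not_orP[Aw Bw]; rewrite ZI// fineK//.
  by apply: contrapT => Iw; apply: Bw; apply: BI => /= /(_ Logic.I).
(* A measurable version of [Z], to which additivity of the integral applies. *)
pose z w := fine (I w).
have mz : measurable_fun setT z by exact: measurableT_comp.
have z0 w : (0 <= z w)%R by exact: fine_ge0.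
have zI w : ~ (A `|` B) w -> (z w)%:E = I w.
  by move=> ABw; rewrite -ZI' ?ZI//; apply: contra_not ABw; left.
have EZ : 'E_P[Z] = r%:E.
  rewrite unlock -Ir.
  by apply: (ge0_integral_eq_off_null mAB AB0) => // w; rewrite lee_fin.
split => //; rewrite /variance unlock EZ/= unlock.
have Ez : \int[P]_w (z w)%:E = r%:E.
  rewrite -Ir.
  by apply: (ge0_integral_eq_off_null mAB AB0) => // w; rewrite lee_fin.
rewrite (_ : \int[P]_w _ = \int[P]_w ((z w - r) ^+ 2)%:E); last first.
  apply: (ge0_integral_eq_off_null mAB AB0) => [w|w|w ABw].
  - by rewrite /= lee_fin -expr2 sqr_ge0.
  - by rewrite lee_fin sqr_ge0.
  by rewrite /= -expr2 /z -ZI'.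
rewrite (_ : \int[P]_w (I w * I w) = \int[P]_w (z w ^+ 2)%:E); last first.
  apply: (ge0_integral_eq_off_null mAB AB0) => [w|w|w ABw].
  - exact: mule_ge0.
  - by rewrite lee_fin sqr_ge0.
  by rewrite expr2 EFinM zI.
set V := \int[P]_w _; set M := \int[P]_w _.
have VM : V + (2 * r ^+ 2)%:E = M + (r ^+ 2)%:E.
  transitivity (\int[P]_w (((z w - r) ^+ 2)%:E + (2 * r)%:E * (z w)%:E)).
    rewrite ge0_integralD//.
    - rewrite ge0_integralZl//.
      + by rewrite Ez -EFinM; congr (_ + _%:E); ring.
      + exact/measurable_EFinP.
      + by move=> w _; rewrite lee_fin.
      + by rewrite lee_fin mulr_ge0.
    - by move=> w _; rewrite lee_fin sqr_ge0.
    - apply/measurable_EFinP; apply: measurable_funX.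
      exact: measurable_funB.
    - by move=> w _; rewrite -EFinM lee_fin !mulr_ge0.
    - apply/measurable_EFinP; exact: measurable_funM.
  transitivity (\int[P]_w ((z w ^+ 2)%:E + (r ^+ 2)%:E)).
    apply: eq_integral => w _; rewrite -EFinM -!EFinD; congr _%:E; ring.
  rewrite ge0_integralD//.
  - by rewrite integral_cst//= probability_setT mule1.
  - by move=> w _; rewrite lee_fin sqr_ge0.
  - by apply/measurable_EFinP; exact: measurable_funX.
  - by move=> w _; rewrite lee_fin sqr_ge0.
(* The added constant is finite, so it cancels even when [V] is infinite. *)
have -> : V = V + (2 * r ^+ 2)%:E - (2 * r ^+ 2)%:E by rewrite addeK.
rewrite VM -addeA; congr (_ + _).
by rewrite -EFinN -EFinD; congr _%:E; ring.
Qed.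

End moments_of_path_integrals.

(** * Integrals under equality in law and under independence *)

Section independence.
Local Open Scope ereal_scope.
Context d (T : measurableType d) (R : realType) (P : probability T R).

Lemma ge0_integral_eq_law (X Y : T -> R) (f : R -> \bar R) :
  measurable_fun setT X -> measurable_fun setT Y ->
  (forall B : set R, measurable B -> P (X @^-1` B) = P (Y @^-1` B)) ->
  measurable_fun setT f -> (forall x, 0 <= f x) ->
  \int[P]_w f (X w) = \int[P]_w f (Y w).
Proof.
move=> mX mY XY mf f0.
transitivity (\int[pushforward P X]_x f x).
  by rewrite (ge0_integral_pushforward mX)//.
rewrite -[RHS](@ge0_integral_pushforward _ _ _ _ _ _ mY P setT f)//.
by apply: eq_measure_integral => B mB _; exact: XY.
Qed.

(** The law of the pair agrees with the product of the two laws on rectangles, hence everywhere by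
    uniqueness of the product measure; Tonelli then factors the integral. *)
Lemma ge0_integral_indep (X Y : T -> R) (f g : R -> \bar R) :
  measurable_fun setT X -> measurable_fun setT Y ->
  (forall A B : set R, measurable A -> measurable B ->
    P (X @^-1` A `&` Y @^-1` B) = P (X @^-1` A) * P (Y @^-1` B)) ->
  measurable_fun setT f -> (forall x, 0 <= f x) ->
  measurable_fun setT g -> (forall x, 0 <= g x) ->
  \int[P]_w (f (X w) * g (Y w)) = \int[P]_w f (X w) * \int[P]_w g (Y w).
Proof.
move=> mX mY XY mf f0 mg g0.
pose X' : {mfun T >-> R} := HB.pack X (isMeasurableFun.Build _ _ _ _ _ mX).
pose Y' : {mfun T >-> R} := HB.pack Y (isMeasurableFun.Build _ _ _ _ _ mY).
pose PX : probability R R := distribution P X'.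
pose PY : probability R R := distribution P Y'.
have mXY : measurable_fun setT (fun w => (X w, Y w)).
  exact: measurable_fun_pair.
pose h (z : R * R) := f z.1 * g z.2.
have mh : measurable_fun setT h.
  by apply: emeasurable_funM; apply: measurableT_comp => //.
have h0 z : 0 <= h z by exact: mule_ge0.
transitivity (\int[pushforward P (fun w => (X w, Y w))]_z h z).
  by rewrite (ge0_integral_pushforward mXY)//.
transitivity (\int[PX \x PY]_z h z).
  apply: eq_measure_integral => B mB _; apply/esym.
  by apply: product_measure_unique => // C D mC mD; rewrite -XY.
rewrite fubini_tonelli1// /fubini_F.
under eq_integral do rewrite /h/= ge0_integralZl//.
rewrite ge0_integralZr//; last exact: integral_ge0.
congr (_ * _).
- by rewrite (ge0_integral_pushforward mX).
- by rewrite (ge0_integral_pushforward mY).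
Qed.

End independence.

(** * The mean as the integral of the survival function *)

Section layer_cake.
Local Open Scope ereal_scope.
Context (R : realType) (Q : probability (measurableTypeR R) R).

Lemma expectation_tail : Q `[0%R, +oo[%classic = 1 ->
  'E_Q[fun x => x] =
  \int[lebesgue_measure]_(s in `[0%R, +oo[) Q `]s, +oo[%classic.
Proof.
move=> Q1.
(* The tail formula asks for a variable that is nonnegative everywhere; [max0] is one, and it is the
   identity on a set of full measure. *)
pose max0 (x : measurableTypeR R) := Num.max (0 : R)%R x.
have mmax : measurable_fun setT max0.
  by apply: measurable_maxr => //; exact: measurable_cst.
pose X : {RV Q >-> R} := HB.pack max0 (isMeasurableFun.Build _ _ _ _ _ mmax).
transitivity ('E_Q[X]).
  rewrite unlock; apply: ae_eq_integral => //; first exact/measurable_EFinP.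
  exists (~` `[0%R, +oo[%classic); split.
  - by apply: measurableC; exact: measurable_itv.
  - have := probability_setC Q (measurable_itv `[0%R, +oo[).
    by rewrite Q1 subee.
  move=> x /= /not_implyP[_ xx] x0; apply: xx; congr _%:E.
  by rewrite in_itv/= andbT in x0; apply/esym/max_idPr.
rewrite ge0_expectation_ccdf; last by move=> x; rewrite /X/= /max0 le_max lexx.
apply: eq_integral => s; rewrite inE/= in_itv/= andbT => s0.
rewrite /ccdf /distribution/= /pushforward; congr (Q _).
apply/seteqP; split => x /=; rewrite !in_itv/= !andbT /max0 lt_max.
  by rewrite ltNge s0.
by move=> ->; rewrite orbT.
Qed.

End layer_cake.

(** * Integrals of exponentials and the tail of the exponential law *)

Section exponential_integrals.
Local Open Scope ereal_scope.
Context (R : realType).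
Let lam := @lebesgue_measure R.

Lemma continuous_expRN (b : R) : continuous (fun x : R => expR (- (b * x))).
Proof.
move=> x; apply: continuous_comp; last exact: continuous_expR.
apply: (@continuousN _ R^o); apply: continuousM => //.
exact: cst_continuous.
Qed.

Lemma is_derive_expRN (b x : R) : b != 0%R ->
  is_derive x 1%R (fun x : R => - (expR (- (b * x)) / b))%R (expR (- (b * x))).
Proof.
move=> b0; apply: is_derive_eq.
rewrite /GRing.scale/= mulr1; by field.
Qed.

(** The sign of [b] is left free because the rate [a2 - a1], which may be negative, occurs in the
    variance of the truncated integral. *)
Lemma integral_expRN_itv (b x y : R) : b != 0%R -> (x < y)%R ->
  \int[lam]_(s in `[x, y]) (expR (- (b * s)))%:E =
  ((expR (- (b * x)) - expR (- (b * y))) / b)%:E.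
Proof.
move=> b0 xy.
have cF z : {for z, continuous (fun x : R => - (expR (- (b * x)) / b))%R}.
  apply: (@continuousN _ R^o); apply: continuousM => //.
    exact: continuous_expRN.
  exact: cst_continuous.
rewrite (@continuous_FTC2 _ _ (fun x : R => - (expR (- (b * x)) / b))%R)//.
- by rewrite -EFinB; congr _%:E; field.
- by apply: continuous_subspaceT; exact: continuous_expRN.
- split.
  + by move=> z _; have [] := is_derive_expRN z b0.
  + by apply/cvg_at_right_filter; exact: cF.
  + by apply/cvg_at_left_filter; exact: cF.
- move=> z _; rewrite derive1E.
  by have dF := is_derive_expRN z b0; rewrite derive_val.
Qed.

Lemma integral_expRN_y (b x : R) : (0 < b)%R ->
  \int[lam]_(s in `[x, +oo[) (expR (- (b * s)))%:E = (expR (- (b * x)) / b)%:E.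
Proof.
move=> b_gt0; have b0 : b != 0%R by rewrite gt_eqF.
have cF z : {for z, continuous (fun x : R => - (expR (- (b * x)) / b))%R}.
  apply: (@continuousN _ R^o); apply: continuousM => //.
    exact: continuous_expRN.
  exact: cst_continuous.
rewrite (@ge0_continuous_FTC2y _ _
  (fun x : R => - (expR (- (b * x)) / b))%R _ 0%R)//.
- by rewrite -EFinB; congr _%:E; rewrite sub0r opprK.
- by apply: continuous_subspaceT; exact: continuous_expRN.
- rewrite -[X in _ --> X]oppr0 -(mul0r b^-1%R).
  apply: cvgN; apply: cvgM; last exact: cvg_cst.
  apply: (@cvg_comp _ _ _ (fun z : R => b * z)%R (fun z : R => expR (- z)) _
    (pinfty_nbhs R)).
    exact: gt0_cvgMry.
  exact: cvgr_expR.
- by apply/cvg_at_right_filter; exact: cF.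
- move=> z _; rewrite derive1E.
  by have dF := is_derive_expRN z b0; rewrite derive_val.
Qed.

Lemma integral_cst_expRN_y (k b x : R) : (0 <= k)%R -> (0 < b)%R ->
  \int[lam]_(s in `[x, +oo[) (k * expR (- (b * s)))%:E =
  (k * (expR (- (b * x)) / b))%:E.
Proof.
move=> k0 b0; under eq_integral do rewrite EFinM.
rewrite ge0_integralZl//; first by rewrite integral_expRN_y.
apply/measurable_EFinP/measurable_funTS.
by apply: continuous_measurable_fun; exact: continuous_expRN.
Qed.

(** Negative [s] are included because the law is later shifted by [x0], which evaluates this tail at
    [s - x0]. *)
Lemma exponential_tail (b : R) : (0 < b)%R ->
  exists E : probability (measurableTypeR R) R, forall s : R,
    E `]s, +oo[%classic = (expR (- (b * Num.max 0 s)))%:E.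
Proof.
move=> b0.
have [E EE] : exists E : probability (measurableTypeR R) R,
    forall A, E A = exponential_prob b A.
  by unshelve eexists; first apply: (exponential_prob b : probability _ R).
exists E.
have tail (s : R) : (0 <= s)%R -> E `]s, +oo[%classic = (expR (- (b * s)))%:E.
  move=> s0; rewrite EE /exponential_prob.
  have mpdf := measurable_exponential_pdf b.
  rewrite integral_itv_obnd_cbnd; last exact/measurable_EFinP/measurable_funTS.
  transitivity (\int[lam]_(x in `[s, +oo[) (b * expR (- (b * x)))%:E).
    apply: eq_integral => x; rewrite inE/= in_itv/= andbT => sx.
    by rewrite exponential_pdfE ?(le_trans s0)// mulNr.
  rewrite integral_cst_expRN_y ?(ltW b0)//.
  by congr _%:E; field; rewrite gt_eqF.
move=> s; have [s0|s0] := leP s 0%R; last by rewrite tail ?ltW.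
rewrite mulr0 oppr0 expR0; apply/eqP; rewrite eq_le probability_le1//=.
rewrite -[leLHS]/(1%:E) -expR0 -[in leLHS]oppr0 -[in leLHS](mulr0 b) -tail//.
by rewrite le_measure ?inE//; exact: subset_itvr.
Qed.

End exponential_integrals.

Lemma measurable_ge0_inv d (T : measurableType d) (R : realType) (f : T -> R) :
  measurable_fun setT f -> (forall x, 0 <= f x) ->
  measurable_fun setT (fun x => (f x)^-1).
Proof.
move=> mf f0.
rewrite (_ : (fun x => _) = (fun x => f x `^ (-1))).
  by apply: (measurableT_comp (measurable_powR (-1))).
by apply/funext => x; rewrite powR_inv1.
Qed.

(** * The minimization over truncation laws of given mean *)

Section optimal_truncation.
Local Open Scope ereal_scope.
Context (R : realType).
Let lam := @lebesgue_measure R.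
Implicit Types (a m s : R) (Q : probability (measurableTypeR R) R).

(** The shift may have either sign: for [x0 > 0] the tail is 1 up to time [x0], and for [x0 < 0] the
    law has an atom at 0 of mass 1 - exp (a x0 / 2). *)
Definition shifted_tail a (x0 : R) s : R :=
  expR (- (a / 2 * Num.max 0 (s - x0)))%R.

Lemma shifted_exponential_law a (x0 : R) : (0 < a)%R ->
  exists2 Q : probability (measurableTypeR R) R, Q `[0%R, +oo[%classic = 1 &
    forall s, (0 <= s)%R -> Q `]s, +oo[%classic = (shifted_tail a x0 s)%:E.
Proof.
move=> a0; have a20 : (0 < a / 2)%R by rewrite divr_gt0.
have [E tailE] := exponential_tail a20.
pose N (x : measurableTypeR R) : measurableTypeR R :=
  Num.max 0%R (x + x0 : R)%R.
have mN : measurable_fun setT N.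
  by apply: measurable_maxr => //; exact: measurable_funD.
pose N' : {mfun measurableTypeR R >-> measurableTypeR R} :=
  HB.pack N (isMeasurableFun.Build _ _ _ _ _ mN).
exists (distribution E N').
  rewrite -(@probability_setT _ _ _ E)/=; congr (E _).
  by apply/seteqP; split => x //= _; rewrite in_itv/= andbT /N le_max lexx.
move=> s s0; rewrite -[RHS]tailE/=; congr (E _).
apply/seteqP; split => x /=; rewrite !in_itv/= !andbT /N lt_max ltNge s0/=.
  by rewrite ltrBlDr.
by rewrite ltrBlDr.
Qed.

(* With [k = exp (- a x0)] the right-hand side is the minimum over [0 < F <= 1]
   of the left-hand side: the constraint [F <= 1] binds for [s <= x0] and
   AM-GM is sharp for [s >= x0]. *)
Lemma shifted_tail_optimal a (x0 : R) s (F : R) (k := expR (- (a * x0))) :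
  (0 < a)%R -> (0 < F)%R -> (F <= 1)%R ->
  (expR (- (a * s)) / shifted_tail a x0 s + k * shifted_tail a x0 s <=
   expR (- (a * s)) / F + k * F)%R.
Proof.
move=> a0 F0 F1; rewrite /shifted_tail.
have k0 : (0 < k)%R by exact: expR_gt0.
have [sx|xs] := leP (s - x0)%R 0%R.
  rewrite mulr0 oppr0 expR0 divr1 mulr1.
  set e := expR _.
  have ke : (k <= e)%R by rewrite ler_expR lerN2 ler_pM2l// -subr_le0.
  (* The tangent of 1 / F at F = 1, with its exact nonnegative remainder. *)
  have -> : (e / F = e + e * (1 - F) + e * (1 - F) ^+ 2 / F)%R.
    by field; rewrite gt_eqF.
  have : (0 <= e * (1 - F) ^+ 2 / F)%R.
    by rewrite divr_ge0 ?(ltW F0)// mulr_ge0 ?sqr_ge0// expR_ge0.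
  have : (k * (1 - F) <= e * (1 - F))%R by rewrite ler_wpM2r// subr_ge0.
  lra.
set f := expR (- (a / 2 * _)).
have f0 : (0 < f)%R by exact: expR_gt0.
(* Thus [f] makes the two summands equal, which is the equality case of AM-GM. *)
have -> : expR (- (a * s)) = (k * f ^+ 2)%R.
  by rewrite /k /f -expRM_natl -expRD; congr expR; field.
have -> : (k * f ^+ 2 / f = k * f)%R by field; rewrite gt_eqF.
have -> : (k * f ^+ 2 / F = k * (f - F) ^+ 2 / F + k * (f + f) - k * F)%R.
  by field; rewrite gt_eqF.
have : (0 <= k * (f - F) ^+ 2 / F)%R.
  by rewrite divr_ge0 ?(ltW F0)// mulr_ge0 ?sqr_ge0// ltW.
lra.
Qed.

Lemma continuous_shifted_tail a (x0 : R) : continuous (shifted_tail a x0).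
Proof.
move=> s; apply: (@continuous_comp _ _ _ (fun s => Num.max 0 (s - x0))%R
  (fun u => expR (- (a / 2 * u))%R)); last exact: continuous_expRN.
apply: (@continuous_max _ _ (fun=> 0%R : R) (fun s => s - x0)%R).
  exact: cst_continuous.
by apply: (@continuousB _ R^o) => //; exact: cst_continuous.
Qed.

Lemma shifted_tail_gt0 a (x0 : R) s : (0 < shifted_tail a x0 s)%R.
Proof. exact: expR_gt0. Qed.

Lemma integral_shifted_tail a m : (0 < a)%R -> (0 < m)%R -> exists x0 : R,
  \int[lam]_(s in `[0%R, +oo[) (shifted_tail a x0 s)%:E = m%:E /\
  \int[lam]_(s in `[0%R, +oo[) (expR (- (a * s)) / shifted_tail a x0 s)%:E =
  (if m <= 2 / a then 4 / (a ^+ 2 * m) else (1 + expR (- (m * a) + 2)) / a)%:E.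
Proof.
move=> a0 m0; have a20 : (0 < a / 2)%R by rewrite divr_gt0.
have a_neq0 : a != 0%R by rewrite gt_eqF.
have tail_ge (x0 s : R) : (x0 <= s)%R ->
    shifted_tail a x0 s = (expR (a / 2 * x0) * expR (- (a / 2 * s)))%R.
  move=> xs; rewrite /shifted_tail (max_idPr _) ?subr_ge0// -expRD.
  by congr expR; ring.
have inv_tail_ge (x0 s : R) : (x0 <= s)%R ->
    (expR (- (a * s)) / shifted_tail a x0 s)%R =
    (expR (- (a / 2 * x0)) * expR (- (a / 2 * s)))%R.
  move=> xs; rewrite tail_ge// -expRD -expRN -!expRD.
  by congr expR; field.
have [ma|ma] := leP m (2 / a)%R.
  (* Here [x0 <= 0], so the tail is a pure exponential on [s >= 0] with integral (2 / a) exp (a x0 /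
     2); setting this equal to [m] gives [x0]. *)
  exists (2 / a * ln (m * a / 2))%R.
  have ma0 : (0 < m * a / 2)%R by rewrite divr_gt0 ?mulr_gt0.
  have x0_le0 : (2 / a * ln (m * a / 2) <= 0)%R.
    rewrite pmulr_rle0 ?divr_gt0// ln_le0// ler_pdivrMr// mul1r.
    by rewrite -ler_pdivlMr.
  have ex0 : expR (a / 2 * (2 / a * ln (m * a / 2))) = (m * a / 2)%R.
    rewrite (_ : _ * _ = ln (m * a / 2))%R ?lnK//.
    by field.
  split.
    transitivity (\int[lam]_(s in `[0%R, +oo[)
        (m * a / 2 * expR (- (a / 2 * s)))%:E).
      apply: eq_integral => s; rewrite inE/= in_itv/= andbT => s0.
      by rewrite tail_ge ?(le_trans x0_le0)// ex0.
    rewrite integral_cst_expRN_y// ?(ltW ma0)// mulr0 oppr0 expR0.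
    by congr _%:E; field.
  transitivity (\int[lam]_(s in `[0%R, +oo[)
      ((m * a / 2)^-1 * expR (- (a / 2 * s)))%:E).
    apply: eq_integral => s; rewrite inE/= in_itv/= andbT => s0.
    by rewrite inv_tail_ge ?(le_trans x0_le0)// expRN ex0.
  rewrite integral_cst_expRN_y ?invr_ge0 ?(ltW ma0)// mulr0 oppr0 expR0.
  by congr _%:E; field; rewrite a_neq0 gt_eqF.
(* Here [x0 > 0] and the mean is x0 + 2 / a. Then a x0 = m a - 2, the origin of the 2 in the
   exponent of the result. *)
exists (m - 2 / a)%R; set x0 := (m - 2 / a)%R.
have x0_gt0 : (0 < x0)%R by rewrite subr_gt0.
have split_int (f : R -> R) : continuous f -> (forall s, (0 <= f s)%R) ->
    \int[lam]_(s in `[0%R, +oo[) (f s)%:E =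
    \int[lam]_(s in `[0%R, x0]) (f s)%:E +
    \int[lam]_(s in `[x0, +oo[) (f s)%:E.
  move=> cf f0.
  have mf D : measurable_fun D (EFin \o f).
    apply/measurable_EFinP/measurable_funTS.
    exact: continuous_measurable_fun.
  have -> : `[0%R, +oo[%classic = `[0%R, x0]%classic `|` `]x0, +oo[%classic.
    by rewrite -itv_bndbnd_setU// bnd_simp ltW.
  rewrite ge0_integral_setU//=.
  - by rewrite (integral_itv_obnd_cbnd (mf _)).
  - exact: mf.
  - by move=> s _; rewrite lee_fin.
  - apply/disj_setPLR => s /=; rewrite !in_itv/= andbT => /andP[_ sx].
    by apply/negP; rewrite -leNgt.
have tail_le (s : R) : (s <= x0)%R -> shifted_tail a x0 s = 1%R.
  by move=> sx; rewrite /shifted_tail (max_idPl _) ?subr_le0// mulr0 oppr0 expR0.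
have ctail := @continuous_shifted_tail a x0.
rewrite split_int//; last by move=> s; exact/ltW/shifted_tail_gt0.
rewrite split_int; last 2 first.
- move=> s; apply: cvgM; first exact: continuous_expRN.
  apply: cvgV; last exact: ctail.
  by rewrite gt_eqF ?shifted_tail_gt0.
- by move=> s; rewrite divr_ge0 ?expR_ge0// ltW// shifted_tail_gt0.
split.
  transitivity (\int[lam]_(s in `[0%R, x0]) (cst 1 s) +
    \int[lam]_(s in `[x0, +oo[)
      (expR (a / 2 * x0) * expR (- (a / 2 * s)))%:E).
    congr (_ + _); apply: eq_integral => s; rewrite inE/= in_itv/= => /andP[].
      by move=> _ sx; rewrite tail_le.
    by move=> xs _; rewrite tail_ge.
  rewrite integral_cst//= mul1e integral_cst_expRN_y ?expR_ge0//.
  rewrite mulrA -expRD subrr expR0 lebesgue_measure_itv/= lte_fin x0_gt0 oppr0.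
  by rewrite -!EFinD; congr _%:E; rewrite /x0; field.
transitivity (\int[lam]_(s in `[0%R, x0]) (expR (- (a * s)))%:E +
  \int[lam]_(s in `[x0, +oo[)
    (expR (- (a / 2 * x0)) * expR (- (a / 2 * s)))%:E).
  congr (_ + _); apply: eq_integral => s; rewrite inE/= in_itv/= => /andP[].
    by move=> _ sx; rewrite tail_le// divr1.
  by move=> xs _; rewrite inv_tail_ge.
rewrite integral_expRN_itv// integral_cst_expRN_y ?expR_ge0//.
rewrite mulrA -expRD mulr0 oppr0 expR0 -EFinD; congr _%:E.
rewrite (_ : - (a / 2 * x0) + _ = - (m * a) + 2)%R; last by rewrite /x0; field.
rewrite (_ : - (a * x0) = - (m * a) + 2)%R; last by rewrite /x0; field.
by field.
Qed.

Definition mean_constrained_laws m : set (probability (measurableTypeR R) R) :=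
  [set Q | truncation_laws Q /\ 'E_Q[fun x => x] = m%:E].

Lemma measurable_tail Q :
  measurable_fun setT (fun s : R => fine (Q `]s, +oo[%classic)).
Proof.
apply: nonincreasing_measurable => // s t st.
rewrite fine_le ?fin_num_measure//; last first.
  by apply: le_measure; rewrite ?inE//; exact: subset_itvr.
Qed.

Lemma measurable_weighted_tail a Q (D : set R) :
  measurable_fun D
    (fun s : R => (expR (- (a * s)) / fine (Q `]s, +oo[%classic))%:E).
Proof.
apply/measurable_EFinP/measurable_funTS/measurable_funM.
  by apply: continuous_measurable_fun; exact: continuous_expRN.
by apply: measurable_ge0_inv; [exact: measurable_tail|move=> s; exact: fine_ge0].
Qed.

Lemma optimal_weighted_tail a m : (0 < a)%R -> (0 < m)%R ->
  let J Q := \int[lam]_(s in `[0%R, +oo[)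
    (expR (- (a * s)) / fine (Q `]s, +oo[%classic))%:E in
  let J0 : \bar R :=
    (if m <= 2 / a then 4 / (a ^+ 2 * m) else (1 + expR (- (m * a) + 2)) / a)%:E
  in (exists2 Q : probability (measurableTypeR R) R,
       mean_constrained_laws m Q & J Q = J0) /\
     (forall Q, mean_constrained_laws m Q -> J0 <= J Q).
Proof.
move=> a0 m0 J J0.
have [x0 [mean_opt J_opt]] := integral_shifted_tail a0 m0.
split.
  have [Q Q0 tailQ] := shifted_exponential_law x0 a0.
  exists Q.
    split.
      by split => // s s0; rewrite tailQ// lte_fin shifted_tail_gt0.
    rewrite expectation_tail// -mean_opt; apply: eq_integral => s.
    by rewrite inE/= in_itv/= andbT => s0; rewrite tailQ.
  rewrite -[J0]/(_%:E) -J_opt; apply: eq_integral => s.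
  by rewrite inE/= in_itv/= andbT => s0; rewrite tailQ.
move=> Q [[Q0 Qpos] EQ].
pose k := expR (- (a * x0)).
have k0 : (0 <= k)%R by exact: expR_ge0.
have mtail D : measurable_fun D (EFin \o shifted_tail a x0).
  apply/measurable_EFinP/measurable_funTS.
  by apply: continuous_measurable_fun; exact: continuous_shifted_tail.
have mQ D : measurable_fun D (fun s : R => (fine (Q `]s, +oo[%classic))%:E).
  by apply/measurable_EFinP/measurable_funTS; exact: measurable_tail.
have meanQ : \int[lam]_(s in `[0%R, +oo[) (fine (Q `]s, +oo[%classic))%:E = m%:E.
  rewrite -EQ expectation_tail//; apply: eq_integral => s _.
  by rewrite fineK ?fin_num_measure.
have mopt D : measurable_fun D
    (fun s => (expR (- (a * s)) / shifted_tail a x0 s)%:E).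
  apply/measurable_EFinP/measurable_funTS/measurable_funM.
    by apply: continuous_measurable_fun; exact: continuous_expRN.
  apply: measurable_ge0_inv; last by move=> s; exact/ltW/shifted_tail_gt0.
  exact/measurable_EFinP.
(* Both tails integrate to [m], so the multiplier term is one finite number on both sides and
   cancels even if [J Q] is infinite. What remains is the integral of the pointwise bound
   [shifted_tail_optimal]. *)
suff : J0 + k%:E * m%:E <= J Q + k%:E * m%:E by rewrite leeD2rE.
rewrite -{1}mean_opt -meanQ -!ge0_integralZl//; last 4 first.
- exact: mQ.
- by move=> s _; rewrite lee_fin fine_ge0.
- exact: mtail.
- by move=> s _; rewrite lee_fin ltW// shifted_tail_gt0.
rewrite /J0 -J_opt /J -ge0_integralD//; last 4 first.
- by move=> s _; rewrite lee_fin divr_ge0 ?expR_ge0// ltW// shifted_tail_gt0.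
- exact: mopt.
- by move=> s _; rewrite -EFinM lee_fin mulr_ge0// ltW// shifted_tail_gt0.
- by apply: measurable_funeM; exact: mtail.
rewrite -ge0_integralD//; last 4 first.
- by move=> s _; rewrite lee_fin divr_ge0 ?expR_ge0// fine_ge0.
- exact: measurable_weighted_tail.
- by move=> s _; rewrite -EFinM lee_fin mulr_ge0// fine_ge0.
- by apply: measurable_funeM; exact: mQ.
apply: ge0_le_integral => //.
- move=> s _; rewrite -EFinM lee_fin addr_ge0//.
    by rewrite divr_ge0 ?expR_ge0// ltW// shifted_tail_gt0.
  by rewrite mulr_ge0// ltW// shifted_tail_gt0.
- by apply: emeasurable_funD; [exact: mopt|apply: measurable_funeM; exact: mtail].
- apply: emeasurable_funD; first exact: measurable_weighted_tail.
  by apply: measurable_funeM; exact: mQ.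
move=> s /=; rewrite in_itv/= andbT => s0.
rewrite -!EFinM -!EFinD lee_fin shifted_tail_optimal//.
- by rewrite -lte_fin fineK ?fin_num_measure// Qpos.
- by rewrite -lee_fin fineK ?fin_num_measure// probability_le1.
Qed.

End optimal_truncation.

(** * Joint measurability and exponential moments of the Lévy process *)

Section levy_moments.
Local Open Scope ereal_scope.
Context d (T : measurableType d) (R : realType) (P : probability T R).
Variables (Y : R -> {RV P >-> R}) (hY : levy_process Y).
Let U := measurableTypeR R.

(* A right-continuous path at time [s] is the limit of its values at the
   times [(floor (s (n + 1)) + 1) / (n + 1)], which decrease to [s]. *)
Lemma levy_jointly_measurable : exists A : set T,
  [/\ measurable A, P A = 0 &
      measurable_fun (~` A `*` (`[0%R, +oo[%classic : set U))
        (fun x : T * U => Y x.2 x.1)].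
Proof.
have [A [mA A0 cadA]] := levy_cadlag hY.
exists A; split => //.
(* The successor makes the approximating time strictly larger than [s], as a right limit at [s]
   requires. *)
pose step (n k : nat) : R := (k.+1%:R / n.+1%:R)%R.
pose index n (s : R) := Num.truncn (s * n.+1%:R)%R.
pose D : set (T * U) := ~` A `*` (`[0%R, +oo[%classic : set U).
have mD : measurable D.
  by apply: measurableX; [exact: measurableC|exact: measurable_itv].
pose h n (x : T * U) := Y (step n (index n x.2)) x.1.
apply: (@measurable_fun_cvg _ _ _ _ h).
  move=> n.
  (* On each of these countably many strips [h n] is the process at one fixed time, hence
     measurable. *)
  pose E k : set (T * U) :=
    D `&` (setT `*` (`[(k%:R / n.+1%:R)%R, (k.+1%:R / n.+1%:R)%R[%classic : set U)).
  have n1 : (0 < n.+1%:R :> R)%R by [].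
  have indexE k s : (k%:R / n.+1%:R <= s < k.+1%:R / n.+1%:R)%R -> index n s = k.
    by move=> /andP[ks sk]; apply: truncn_def; rewrite -ler_pdivrMr// ks -ltr_pdivlMr.
  rewrite -/D (_ : D = \bigcup_k E k); last first.
    apply/seteqP; split => [x Dx|x [k _ []]//].
    exists (index n x.2) => //; split => //; split => //=.
    have [_ /=] := Dx; rewrite in_itv/= andbT => x0.
    rewrite in_itv/= ler_pdivrMr// ltr_pdivlMr//.
    by rewrite truncn_itv// mulr_ge0.
  apply/measurable_fun_bigcup.
    move=> k; apply: measurableI => //; apply: measurableX => //.
  move=> k; apply: (@eq_measurable_fun _ _ _ _ _ (fun x => Y (step n k) x.1)).
    move=> x /set_mem[_ [_ /=]]; rewrite in_itv/= => /indexE xk.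
    by rewrite /h xk.
  apply: measurable_funTS; exact: measurableT_comp.
move=> x [/= Ax]; rewrite in_itv/= andbT => x0.
have cad : cadlag (fun t => Y t x.1).
  by apply: contrapT => ncad; apply: Ax; exact: cadA.
have /cvg_at_rightP := cad.1 _ x0; apply.
split.
  move=> n; rewrite /step ltr_pdivlMr// /index.
  exact: truncnS_gt.
apply/cvgrPdist_le => e e0; near=> n.
rewrite /step distrC ger0_norm; last first.
  by rewrite subr_ge0 ler_pdivlMr// ltW// truncnS_gt.
rewrite lerBlDl ler_pdivrMr// mulrDl -addn1 natrD lerD//.
  by rewrite /index truncn_le// mulr_ge0.
rewrite -ler_pdivrMr// div1r ltW//.
near: n; exact: (near_infty_natSinv_lt (PosNum e0)).
Unshelve. all: by end_near. Qed.

Variables (phi : R -> \bar R) (hphi : characteristic_exponent Y phi).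

(** The value -oo would make the mean of exp (b Y_1) equal to 0, although this variable is positive
    everywhere. *)
Lemma exponent_fin_num b : phi b < +oo -> phi b \is a fin_num.
Proof.
move=> phi_lt; rewrite fin_numE andbC lt_eqF//=; apply/eqP => phiNy.
have := hphi b ler01; rewrite phiNy mul1e/= unlock => E0.
have mf : measurable_fun setT (fun w => (expR (b * Y 1 w))%:E).
  by apply/measurable_EFinP/measurableT_comp => //; exact: measurable_funM.
have : \int[P]_w `|(expR (b * Y 1 w))%:E| = 0.
  by rewrite -E0; apply: eq_integral => w _; rewrite gee0_abs// lee_fin expR_ge0.
move=> /(ae_eq_integral_abs P measurableT mf)[N [mN N0 subN]].
have NT : N = setT.
  apply/seteqP; split => // w _; apply: subN => /= /(_ Logic.I) /eqP.
  by rewrite eqe expR_eq0.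
have PN1 : P N = 1 by rewrite NT probability_setT.
by have /eqP := etrans (esym PN1) N0; rewrite onee_eq0.
Qed.

Lemma integral_exp_levy b t : (0 <= t)%R -> phi b \is a fin_num ->
  \int[P]_w (expR (b * Y t w))%:E = (expR (t * fine (phi b)))%:E.
Proof.
move=> t0 phi_fin; have := hphi b t0.
by rewrite unlock -[in X in expeR X](fineK phi_fin).
Qed.

Lemma integral_exp_increment b s t : (0 <= s)%R -> (s <= t)%R ->
  phi b \is a fin_num ->
  \int[P]_w (expR (b * (Y t w - Y s w)))%:E =
  (expR ((t - s) * fine (phi b)))%:E.
Proof.
move=> s0 st phi_fin.
rewrite -integral_exp_levy ?subr_ge0//.
apply: (ge0_integral_eq_law (f := fun y => (expR (b * y))%:E)) => //.
- exact: measurable_funB.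
- exact: levy_stationary_increments hY _ _ s0 st.
- by apply/measurable_EFinP/measurableT_comp => //; exact: measurable_funM.
Qed.

(** Almost surely Y_0 = 0, so b Y_s + b Y_t = 2 b (Y_s - Y_0) + b (Y_t - Y_s), a sum of independent
    terms; the first one brings in the exponent at [2 * b]. *)
Lemma integral_exp_levy2 b s t : (0 <= s)%R -> (s <= t)%R ->
  phi b \is a fin_num -> phi (2 * b)%R \is a fin_num ->
  \int[P]_w (expR (b * Y s w) * expR (b * Y t w))%:E =
  (expR (s * fine (phi (2 * b)%R)) * expR ((t - s) * fine (phi b)))%:E.
Proof.
move=> s0 st phi_fin phi2_fin.
have [A [mA A0 start]] := levy_start hY.
pose V w := (Y s w - Y 0%R w)%R.
pose W w := (Y t w - Y s w)%R.
have Y0 w : ~ A w -> Y 0%R w = 0%R.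
  by move=> Aw; apply: contrapT => Yw; apply: Aw; exact: start.
have mexp (a : R) : measurable_fun setT (fun y : R => (expR (a * y))%:E).
  by apply/measurable_EFinP/measurableT_comp => //; exact: measurable_funM.
transitivity (\int[P]_w ((expR (2 * b * V w))%:E * (expR (b * W w))%:E)).
  apply: (ge0_integral_eq_off_null mA A0) => [w|w|w Aw].
  - by rewrite lee_fin mulr_ge0// expR_ge0.
  - by rewrite -EFinM lee_fin mulr_ge0// expR_ge0.
  rewrite -EFinM -!expRD /V /W Y0//; congr (expR _)%:E; ring.
rewrite (ge0_integral_indep (f := fun y => (expR (2 * b * y))%:E)
  (g := fun y => (expR (b * y))%:E)).
- by rewrite !integral_exp_increment ?lexx// subr0 EFinM.
- exact: measurable_funB.
- exact: measurable_funB.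
- move=> B C mB mC.
  (* The times 0, s, t, continued by the constant t to give a nondecreasing sequence; only the first
     two increments are used. *)
  pose ts (i : nat) : R := if i is i'.+1 then if i' is _.+1 then t else s else 0%R.
  have ts_le i : (ts i <= ts i.+1)%R by case: i => [|[|i]].
  have ts0 : (0 <= ts 0%N)%R by [].
  have := @levy_independent_increments _ _ _ _ _ hY 2 ts ts0 ts_le.
  move=> /(_ (fun i => if i == ord0 then B else C)).
  rewrite !big_ord_recl big_ord0 mule1/=.
  have -> : \bigcap_(i in [set: 'I_2])
      ((fun w => Y (ts i.+1) w - Y (ts i) w)%R @^-1`
         (if i == ord0 then B else C)) =
    V @^-1` B `&` W @^-1` C.
    apply/seteqP; split => w /=.
      by move=> h; split; [exact: (h ord0 Logic.I)|exact: (h ord_max Logic.I)].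
    by move=> [hB hC] [[|[|i]] hi] _ //.
  by apply => i; case: ifP.
- exact: mexp.
- by move=> y; rewrite lee_fin expR_ge0.
- exact: mexp.
- by move=> y; rewrite lee_fin expR_ge0.
Qed.

End levy_moments.

(** * Means and variances of the integral estimators *)

Section path_integral_moments.
Local Open Scope ereal_scope.
Context (R : realType).
Let U := measurableTypeR R.
Let lam : {sigma_finite_measure set U -> \bar R} := @lebesgue_measure R.

(** Reduces both moments to one-time and two-time means of [h], the quantities that the process
    determines. The actual path integral [Z] need only agree with that of [h] off [A]. *)
Lemma path_integral_mean_variance d (T : measurableType d)
    (P : probability T R) (A : set T) (h : T * U -> \bar R) (Z : T -> R) (r : R) :
  measurable A -> P A = 0 -> measurable_fun setT h -> (forall x, 0 <= h x) ->
  (forall w, (0 <= Z w)%R) ->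
  (forall w, ~ A w -> Z w = fine (\int[lam]_s h (w, s))) ->
  \int[lam]_s \int[P]_w h (w, s) = r%:E ->
  'E_P[Z] = r%:E /\
  'V_P[Z] = 2%:E * \int[lam]_s \int[lam]_t
    (if (s < t)%R then \int[P]_w (h (w, s) * h (w, t)) else 0) - (r ^+ 2)%:E.
Proof.
move=> mA A0 mh h0 Z0 Zh hr.
rewrite -integral_path_square//.
apply: (expectation_variance_fine mA A0) => //.
- exact: (@measurable_fun_fubini_tonelli_F _ _ _ _ _ lam h).
- by move=> w; exact: integral_ge0.
- by rewrite -hr (@fubini_tonelli _ _ _ _ _ P lam h).
Qed.

Context d (T : measurableType d) (P : probability T R).
Variables (G : R -> T -> R) (A : set T) (a1 a2 : R).
Let D : set (T * U) := ~` A `*` (`[0%R, +oo[%classic : set U).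
Hypotheses (mA : measurable A) (A0 : P A = 0).
Hypothesis G_ge0 : forall s w, (0 <= G s w)%R.
Hypothesis mG : measurable_fun D (fun x : T * U => G x.2 x.1).
Hypotheses (a1_gt0 : (0 < a1)%R) (a2_gt0 : (0 < a2)%R).
Hypothesis mean_G : forall s, (0 <= s)%R ->
  \int[P]_w (G s w)%:E = (expR (- (a1 * s)))%:E.
Hypothesis corr_G : forall s t, (0 <= s)%R -> (s <= t)%R ->
  \int[P]_w (G s w * G t w)%:E =
  (expR (- (a2 * s)) * expR (- (a1 * (t - s))))%:E.

(** Cutting [G] off outside [D] makes it measurable on the whole product; paths off the null set [A]
    keep their values at all times [s >= 0]. *)
Let H : T * U -> \bar R := (fun x : T * U => (G x.2 x.1)%:E) \_ D.

Let H_ge0 x : 0 <= H x.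
Proof. by rewrite /H patchE; case: ifP => // _; rewrite lee_fin. Qed.

Let HE w s : ~ A w -> (0 <= s)%R -> H (w, s) = (G s w)%:E.
Proof.
by move=> Aw s0; rewrite /H patchE mem_set//; split => //=; rewrite in_itv/= s0.
Qed.

Let H_lt0 w s : (s < 0)%R -> H (w, s) = 0.
Proof.
move=> s0; rewrite /H patchE memNset// => -[_ /=].
by rewrite in_itv/= andbT leNgt s0.
Qed.

Let mH : measurable_fun setT H.
Proof.
have mD : measurable D.
  by apply: measurableX; [exact: measurableC|exact: measurable_itv].
have mEG : measurable_fun D (fun x : T * U => (G x.2 x.1)%:E).
  exact/measurable_EFinP.
exact: (measurable_restrictT _ mD).1 mEG.
Qed.

Let mHs s : measurable_fun setT (fun w => H (w, s)).
Proof. by apply: (measurableT_comp mH); exact: pair2_measurable. Qed.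

Let mHw w : measurable_fun setT (fun s => H (w, s)).
Proof. by apply: (measurableT_comp mH); exact: pair1_measurable. Qed.

Let mean_H s : (0 <= s)%R -> \int[P]_w H (w, s) = (expR (- (a1 * s)))%:E.
Proof.
move=> s0; rewrite -mean_G//.
apply: (ge0_integral_eq_off_null mA A0) => // w; last by move=> Aw; rewrite HE.
by rewrite lee_fin.
Qed.

Let corr_H s t : (0 <= s)%R -> (s <= t)%R ->
  \int[P]_w (H (w, s) * H (w, t)) =
  (expR (- (a2 * s)) * expR (- (a1 * (t - s))))%:E.
Proof.
move=> s0 st; rewrite -corr_G//.
apply: (ge0_integral_eq_off_null mA A0) => w.
- exact: mule_ge0.
- by rewrite lee_fin mulr_ge0.
- by move=> Aw; rewrite !HE ?EFinM// (le_trans s0).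
Qed.

Lemma interval_integral_mean_variance (J : set U) (r : R) :
  measurable J -> J `<=` `[0%R, +oo[%classic ->
  \int[lam]_(s in J) (expR (- (a1 * s)))%:E = r%:E ->
  let Z := fun w => (\int[lebesgue_measure]_(s in J) G s w)%R in
  'E_P[Z] = r%:E /\
  'V_P[Z] = 2%:E * \int[lam]_(s in J) \int[lam]_(t in J)
    (if (s < t)%R
     then (expR (- (a2 * s)) * expR (- (a1 * (t - s))))%:E else 0)
    - (r ^+ 2)%:E.
Proof.
move=> mJ J0 Jr Z.
pose h : T * U -> \bar R := H \_ (setT `*` J).
have hE w s : h (w, s) = ((fun s => H (w, s)) \_ J) s.
  rewrite /h !patchE; congr (if _ then _ else _).
  by apply/idP/idP; rewrite !inE; [move=> []|].
have mh : measurable_fun setT h.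
  apply/(measurable_restrictT _ _).1; first exact: measurableX.
  exact: measurable_funTS.
have h0 x : 0 <= h x by rewrite /h patchE; case: ifP.
have J_ge0 s : J s -> (0 <= s)%R by move=> /J0/=; rewrite in_itv/= andbT.
have Zh w : ~ A w -> Z w = fine (\int[lam]_s h (w, s)).
  move=> Aw; rewrite /Z /Rintegral; congr fine.
  under [RHS]eq_integral do rewrite hE.
  rewrite -integral_mkcond; apply: eq_integral => s /set_mem Js.
  by rewrite HE//; exact: J_ge0.
have Z0 w : (0 <= Z w)%R by apply: Rintegral_ge0 => s _.
have meanh : \int[lam]_s \int[P]_w h (w, s) = r%:E.
  rewrite -Jr [RHS]integral_mkcond; apply: eq_integral => s _.
  under eq_integral do rewrite hE patchE.
  rewrite patchE; case: ifPn => [/set_mem Js|_]; last by rewrite integral0.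
  by rewrite mean_H//; exact: J_ge0.
have [-> ->] := path_integral_mean_variance mA A0 mh h0 Z0 Zh meanh.
suff -> : \int[lam]_s \int[lam]_t
    (if (s < t)%R then \int[P]_w (h (w, s) * h (w, t)) else 0) =
    \int[lam]_(s in J) \int[lam]_(t in J) (if (s < t)%R
      then (expR (- (a2 * s)) * expR (- (a1 * (t - s))))%:E else 0) by [].
rewrite [RHS]integral_mkcond; apply: eq_integral => s _.
rewrite patchE; case: ifPn => [/set_mem Js|Js]; last first.
  apply: integral0_eq => t _; case: ifP => // _.
  by apply: integral0_eq => w _; rewrite hE patchE (negbTE Js) mul0e.
rewrite [RHS]integral_mkcond; apply: eq_integral => t _.
rewrite patchE; have [/set_mem Jt|Jt] := boolP (t \in J); last first.
  case: ifP => // _.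
  by apply: integral0_eq => w _; rewrite !hE [X in _ * X]patchE (negbTE Jt) mule0.
case: ifPn => // st.
under eq_integral do rewrite !hE !patchE !mem_set//.
by rewrite corr_H ?J_ge0// ltW.
Qed.

(** * The estimator stopped at an independent random time *)

Section randomized.
Variable Q : probability U R.
Hypothesis Q_gt0 : forall s : R, (0 <= s)%R -> 0 < Q `]s, +oo[%classic.
Let F (s : R) : R := fine (Q `]s, +oo[%classic).

Let F_ge0 s : (0 <= F s)%R. Proof. exact: fine_ge0. Qed.

Let F_gt0 s : (0 <= s)%R -> (0 < F s)%R.
Proof. by move=> /Q_gt0; rewrite -lte_fin fineK ?fin_num_measure. Qed.

(** Integrating out the random time replaces the event that it exceeds [s] by the factor [F s]. This
    factor cancels the weight 1 / F s, which makes the estimator unbiased. *)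
Let integral_survival (g : T -> \bar R) (s : R) : measurable_fun setT g ->
  (forall w, 0 <= g w) ->
  \int[P \x Q]_x (if (s < x.2)%R then g x.1 else 0) = \int[P]_w g w * (F s)%:E.
Proof.
move=> mg g0.
rewrite fubini_tonelli1/=; last 2 first.
- apply: measurable_ltr_if => //; exact: measurableT_comp.
- by move=> x; case: ifP.
rewrite -ge0_integralZr//; last by rewrite lee_fin.
apply: eq_integral => w _; rewrite /fubini_F/=.
transitivity (\int[Q]_y (g w * (\1_(`]s, +oo[%classic) y)%:E)).
  apply: eq_integral => y _; rewrite indicE.
  have [sy|ys] := ltP s y; first by rewrite mem_set ?mule1//= in_itv/= sy.
  by rewrite memNset ?mule0//= in_itv/= andbT ltNge ys.
rewrite ge0_integralZl//; last first.
  by apply/measurable_EFinP; exact: measurable_indic.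
by rewrite integral_indic// setIT fineK// fin_num_measure.
Qed.

(** For s < t, a random time beyond t is also beyond s. The two weights 1 / (F s * F t) thus meet
    the single probability [F t], leaving 1 / F s; integrating exp (- a1 (t - s)) over t > s gives
    the factor 1 / a1. *)
Lemma randomized_integral_mean_variance :
  'E_(P \x Q)[randomized_integral G Q] = (a1^-1)%:E /\
  'V_(P \x Q)[randomized_integral G Q] =
  (2 / a1)%:E * \int[lam]_(s in `[0%R, +oo[) (expR (- (a2 * s)) / F s)%:E
  - (a1^-1 ^+ 2)%:E.
Proof.
pose AT : set (T * U) := A `*` setT.
have mAT : measurable AT by exact: measurableX.
have AT0 : (P \x Q) AT = 0.
  transitivity (P A * Q setT); first exact: product_measure1E.
  by rewrite A0 mul0e.
pose h : T * U * U -> \bar R := fun x =>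
  if (x.2 < x.1.2)%R then H (x.1.1, x.2) * (F x.2)^-1%:E else 0.
have mF : measurable_fun setT F by exact: measurable_tail.
have mFV : measurable_fun setT (fun s => (F s)^-1%R) by exact: measurable_ge0_inv.
have m12 : measurable_fun setT (fun x : T * U * U => x.1.2).
  by apply: (measurableT_comp measurable_snd); exact: measurable_fst.
have m11 : measurable_fun setT (fun x : T * U * U => x.1.1).
  by apply: (measurableT_comp measurable_fst); exact: measurable_fst.
have mh : measurable_fun setT h.
  apply: (measurable_ltr_if measurable_snd m12).
  apply: emeasurable_funM.
    by apply: (measurableT_comp mH); exact: measurable_fun_pair.
  by apply/measurable_EFinP; apply: (measurableT_comp mFV); exact: measurable_snd.
have HF_ge0 w s : 0 <= H (w, s) * (F s)^-1%:E.
  by rewrite mule_ge0// lee_fin invr_ge0.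
have h0 x : 0 <= h x by rewrite /h; case: ifP.
have Z0 x : (0 <= randomized_integral G Q x)%R.
  by apply: Rintegral_ge0 => s _; rewrite divr_ge0// fine_ge0.
have Zh x : ~ AT x ->
    randomized_integral G Q x = fine (\int[lam]_s h (x, s)).
  case: x => w n ATx; have Aw : ~ A w by move=> Aw; apply: ATx.
  rewrite /randomized_integral /Rintegral/=; congr fine.
  transitivity (\int[lam]_(s in `[0%R, n]) (H (w, s) * (F s)^-1%:E)).
    apply: eq_integral => s; rewrite inE/= in_itv/= => /andP[s0 _].
    by rewrite HE.
  (* Dropping the right endpoint matches the strict inequality [s < n] in [h], that is the event N >
     s whose probability is the weight. *)
  rewrite -integral_itv_bndo_bndc; last first.
    apply: measurable_funTS; apply: emeasurable_funM; first exact: mHw.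
    exact/measurable_EFinP.
  rewrite integral_mkcond; apply: eq_integral => s _.
  rewrite patchE /h/=; have [s0|s0] := leP 0%R s; last first.
    by rewrite H_lt0// mul0e !if_same.
  by rewrite mem_setE in_itv/= s0.
have h_pair s : (0 <= s)%R ->
    \int[P \x Q]_x h (x, s) = (expR (- (a1 * s)))%:E.
  move=> s0.
  rewrite (integral_survival (g := fun w => H (w, s) * (F s)^-1%:E))//; last first.
    by apply: emeasurable_funM => //; exact: measurable_cst.
  rewrite ge0_integralZr//; last by rewrite lee_fin invr_ge0.
  by rewrite mean_H// -!EFinM mulfVK// gt_eqF ?F_gt0.
have h_lt0 x s : (s < 0)%R -> h (x, s) = 0.
  by move=> s0; rewrite /h/= H_lt0// mul0e if_same.
have h_corr s t : (0 <= s)%R -> (s < t)%R ->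
    \int[P \x Q]_x (h (x, s) * h (x, t)) =
    (expR (- (a2 * s)) * expR (- (a1 * (t - s))) / F s)%:E.
  move=> s0 st.
  transitivity (\int[P \x Q]_x (if (t < x.2)%R
      then H (x.1, s) * H (x.1, t) * ((F s)^-1 * (F t)^-1)%:E else 0)).
    apply: eq_integral => x _; rewrite /h/=.
    have [tx|_] := ltP t x.2; last by rewrite mule0.
    by rewrite (lt_trans st)// muleACA -EFinM.
  rewrite (integral_survival
    (g := fun w => H (w, s) * H (w, t) * ((F s)^-1 * (F t)^-1)%:E)).
  - rewrite ge0_integralZr//.
    + rewrite corr_H ?(ltW st)// -!EFinM; congr _%:E; field.
      by rewrite !gt_eqF ?F_gt0// (le_trans s0)// ltW.
    + by apply: emeasurable_funM.
    + by move=> w _; exact: mule_ge0.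
    + by rewrite lee_fin mulr_ge0 ?invr_ge0.
  - apply: emeasurable_funM; last exact: measurable_cst.
    exact: emeasurable_funM.
  - by move=> w; rewrite !mule_ge0// lee_fin mulr_ge0 ?invr_ge0.
have meanh : \int[lam]_s \int[P \x Q]_x h (x, s) = (a1^-1)%:E.
  transitivity (\int[lam]_(s in `[0%R, +oo[) (expR (- (a1 * s)))%:E).
    rewrite [RHS]integral_mkcond; apply: eq_integral => s _.
    rewrite patchE mem_setE in_itv/= andbT; have [s0|s0] := leP 0%R s.
      by rewrite h_pair.
    by apply: integral0_eq => x _; rewrite h_lt0.
  by rewrite integral_expRN_y// mulr0 oppr0 expR0 div1r.
have [-> ->] := path_integral_mean_variance mAT AT0 mh h0 Z0 Zh meanh.
suff -> : \int[lam]_s \int[lam]_t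
    (if (s < t)%R then \int[P \x Q]_x (h (x, s) * h (x, t)) else 0) =
    (a1^-1)%:E * \int[lam]_(s in `[0%R, +oo[) (expR (- (a2 * s)) / F s)%:E.
  by split; rewrite // muleA -EFinM.
rewrite -ge0_integralZl//; last 3 first.
- exact: measurable_weighted_tail.
- by move=> s _; rewrite lee_fin divr_ge0 ?expR_ge0.
- by rewrite lee_fin invr_ge0 ltW.
rewrite [RHS]integral_mkcond; apply: eq_integral => s _.
rewrite patchE mem_setE in_itv/= andbT; have [s0|s0] := leP 0%R s; last first.
  apply: integral0_eq => t _; case: ifP => // _.
  by apply: integral0_eq => x _; rewrite h_lt0// mul0e.
transitivity (\int[lam]_(t in `]s, +oo[)
    (expR (- (a2 * s)) / F s * expR (a1 * s) * expR (- (a1 * t)))%:E).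
  rewrite [RHS]integral_mkcond; apply: eq_integral => t _.
  rewrite patchE mem_setE in_itv/= andbT; case: ifPn => // st.
  rewrite h_corr//; congr _%:E.
  rewrite (_ : - (a1 * (t - s)) = a1 * s + - (a1 * t))%R; last by ring.
  by rewrite expRD; ring.
rewrite integral_itv_obnd_cbnd; last first.
  apply/measurable_EFinP/measurable_funTS/measurable_funM => //.
  by apply: continuous_measurable_fun; exact: continuous_expRN.
rewrite integral_cst_expRN_y//; last by rewrite !mulr_ge0 ?invr_ge0 ?expR_ge0.
rewrite -EFinM [expR (- (a1 * s))]expRN; congr _%:E; field.
by rewrite !gt_eqF ?F_gt0 ?expR_gt0.
Qed.

End randomized.

Lemma tail_integral_mean (m : R) : (0 <= m)%R ->
  'E_P[fun w => (\int[lebesgue_measure]_(s in `[m, +oo[) G s w)%R] =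
  (expR (- (a1 * m)) / a1)%:E.
Proof.
move=> m0.
apply: (proj1 (@interval_integral_mean_variance `[m, +oo[%classic _ _ _ _)).
- exact: measurable_itv.
- by apply: subset_itvr; rewrite bnd_simp.
- by rewrite integral_expRN_y.
Qed.

Hypothesis a12 : a2 != a1.

Lemma truncated_integral_variance (m : R) : (0 < m)%R ->
  'V_P[truncated_integral G m] =
  (2 * (1 - expR (- (m * a2))) / (a1 * a2)
   + (2 * expR (- (m * a2)) - 2 * expR (- (m * a1))) / (a1 * (a2 - a1))
   - ((1 - expR (- (m * a1))) / a1) ^+ 2)%:E.
Proof.
move=> m0.
have mexp (b : R) (E : set R) :
    measurable_fun E (fun s : R => (expR (- (b * s)))%:E).
  apply/measurable_EFinP/measurable_funTS.
  by apply: continuous_measurable_fun; exact: continuous_expRN.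
have a1_neq0 : a1 != 0%R by rewrite gt_eqF.
have a2_neq0 : a2 != 0%R by rewrite gt_eqF.
have a21_neq0 : (a2 - a1)%R != 0%R by rewrite subr_eq0.
have mean_trunc : \int[lam]_(s in `[0%R, m]) (expR (- (a1 * s)))%:E =
    ((1 - expR (- (a1 * m))) / a1)%:E.
  by rewrite integral_expRN_itv// mulr0 oppr0 expR0.
have [|| _] := @interval_integral_mean_variance `[0%R, m]%classic _ _ _ mean_trunc.
- exact: measurable_itv.
- by apply: subset_itvl.
rewrite -/(truncated_integral G m) => ->.
(* The inner integral over t in [s, m], in closed form. *)
pose k (s : R) : R :=
  (expR (- (a2 * s)) * (1 - expR (- (a1 * (m - s)))) / a1)%R.
have inner s : `[0%R, m]%classic s -> \int[lam]_(t in `[0%R, m])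
    (if (s < t)%R
     then (expR (- (a2 * s)) * expR (- (a1 * (t - s))))%:E else 0) = (k s)%:E.
  rewrite /= in_itv/= => /andP[s0 sm].
  transitivity (\int[lam]_(t in `]s, m])
      ((expR (- (a2 * s)) * expR (a1 * s))%:E * (expR (- (a1 * t)))%:E)).
    rewrite [LHS]integral_mkcond [RHS]integral_mkcond.
    apply: eq_integral => t _; rewrite !patchE !mem_setE !in_itv/=.
    have [st|ts] := ltP s t; last by rewrite if_same.
    rewrite (le_trans s0 (ltW st))/=; case: ifP => // _.
    rewrite -EFinM -!expRD; congr (expR _)%:E; ring.
  rewrite integral_itv_obnd_cbnd; last exact: measurable_funeM.
  rewrite ge0_integralZl//; last exact: mexp.
  rewrite /k (_ : - (a1 * (m - s)) = a1 * s + - (a1 * m))%R; last by ring.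
  move: sm; rewrite le_eqVlt => /predU1P[->|sm].
    by rewrite set_itv1 integral_set1 mule0 subrr expR0 subrr mulr0 mul0r.
  rewrite integral_expRN_itv// -EFinM expRD [expR (- (a1 * s))]expRN.
  congr _%:E; field.
  by rewrite a1_neq0 gt_eqF ?expR_gt0.
have k_ge0 s : `[0%R, m]%classic s -> (0 <= k s)%R.
  rewrite /= in_itv/= => /andP[s0 sm].
  rewrite /k divr_ge0 ?(ltW a1_gt0)// mulr_ge0 ?expR_ge0// subr_ge0.
  by rewrite -expR0 ler_expR oppr_le0 mulr_ge0 ?subr_ge0// ltW.
have mk : measurable_fun `[0%R, m] (fun s => (k s)%:E).
  apply/measurable_EFinP/measurable_funTS; apply: measurable_funM => //.
  apply: measurable_funM; first by apply/measurable_EFinP; exact: mexp.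
  apply: measurable_funB => //.
  rewrite (_ : (fun s => _) =
      fun s : R => expR (- (- a1 * s)) * expR (- (a1 * m)))%R.
    apply: measurable_funM; last exact: measurable_cst.
    by apply/measurable_EFinP; exact: mexp.
  by apply/funext => s; rewrite -expRD; congr expR; ring.
under eq_integral => s /set_mem Js do rewrite (inner _ Js).
set V := \int[lam]_(s in _) _.
(* [k] is a difference of two exponentials in s, of rates [a2] and [a2 - a1]. Adding the second back
   keeps every integrand nonnegative and leaves exp (- a2 s) / a1. *)
have V_add : V + ((1 - expR (- ((a2 - a1) * m))) / (a2 - a1) *
      (expR (- (a1 * m)) / a1))%:E = ((1 - expR (- (a2 * m))) / a2 / a1)%:E.
  transitivity (V + \int[lam]_(s in `[0%R, m])
      ((expR (- (a1 * m)) / a1)%:E * (expR (- ((a2 - a1) * s)))%:E)).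
    rewrite ge0_integralZl//.
    - rewrite integral_expRN_itv// mulr0 oppr0 expR0 -EFinM.
      by congr (_ + _%:E); rewrite mulrC.
    - exact: mexp.
    - by rewrite lee_fin divr_ge0 ?expR_ge0// ltW.
  rewrite -ge0_integralD//.
  - transitivity (\int[lam]_(s in `[0%R, m])
        ((expR (- (a2 * s)))%:E * (a1^-1)%:E)).
      apply: eq_integral => s _; rewrite -!EFinM -EFinD /k; congr _%:E.
      rewrite (_ : - (a1 * (m - s)) = - (a1 * m) + a1 * s)%R; last by ring.
      rewrite (_ : - ((a2 - a1) * s) = - (a2 * s) + a1 * s)%R; last by ring.
      by rewrite !expRD; field.
    rewrite ge0_integralZr//.
    - by rewrite integral_expRN_itv// mulr0 oppr0 expR0 -EFinM.
    - exact: mexp.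
    - by rewrite lee_fin invr_ge0 ltW.
  - by move=> t _; rewrite -EFinM lee_fin mulr_ge0 ?divr_ge0 ?expR_ge0// ltW.
  - by apply: measurable_funeM; exact: mexp.
have -> : V = V + ((1 - expR (- ((a2 - a1) * m))) / (a2 - a1) *
      (expR (- (a1 * m)) / a1))%:E - ((1 - expR (- ((a2 - a1) * m))) / (a2 - a1) *
      (expR (- (a1 * m)) / a1))%:E by rewrite addeK.
rewrite V_add -EFinB; congr _%:E.
rewrite !(mulrC m).
rewrite (_ : - ((a2 - a1) * m) = - (a2 * m) + a1 * m)%R; last by ring.
rewrite expRD [expR (- (a1 * m))]expRN; field.
by rewrite a1_neq0 a2_neq0 a21_neq0 gt_eqF ?expR_gt0.
Qed.

End path_integral_moments.

(** * Inequalities behind the positivity of the denominator *)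

Lemma mean_square_bound (R : realType) d (T : measurableType d)
    (P : probability T R) (Z : T -> R) (r v : R) :
  measurable_fun setT Z -> (forall w, 0 <= Z w) ->
  (\int[P]_w (Z w)%:E = r%:E)%E -> (\int[P]_w (Z w * Z w)%:E = v%:E)%E ->
  r ^+ 2 <= v.
Proof.
move=> mZ Z0 Zr Zv.
have mZE : measurable_fun setT (fun w => (Z w)%:E) by exact/measurable_EFinP.
have Z0E w : (0 <= (Z w)%:E)%E by rewrite lee_fin.
have [_ VZ] := expectation_variance_fine measurable0 (measure0 P) mZE Z0E Z0
  (fun w _ => erefl : Z w = fine (Z w)%:E) Zr.
have := variance_ge0 P Z; rewrite VZ.
under eq_integral do rewrite -EFinM.
by rewrite Zv -EFinB lee_fin subr_ge0.
Qed.

(** Each side is the integral of exp (- b s) over [0, m], and the integrand decreases in b, whatever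
    the sign of b. *)
Lemma expRN_mean_value_le (R : realType) (b1 b2 m : R) :
  b1 != 0 -> b2 != 0 -> 0 < m -> b1 <= b2 ->
  (1 - expR (- (b2 * m))) / b2 <= (1 - expR (- (b1 * m))) / b1.
Proof.
move=> b10 b20 m0 b12.
have mexp (b : R) (E : set R) :
    measurable_fun E (fun s : R => (expR (- (b * s)))%:E).
  apply/measurable_EFinP/measurable_funTS.
  by apply: continuous_measurable_fun; exact: continuous_expRN.
have meanE (b : R) : b != 0 -> ((1 - expR (- (b * m))) / b)%:E =
    (\int[lebesgue_measure]_(s in `[0%R, m]) (expR (- (b * s)))%:E)%E.
  by move=> b0; rewrite integral_expRN_itv// mulr0 oppr0 expR0.
rewrite -lee_fin !meanE//; apply: ge0_le_integral => //.
- exact: mexp.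
- exact: mexp.
move=> s /=; rewrite in_itv/= => /andP[s0 _].
by rewrite lee_fin ler_expR lerN2 ler_wpM2r.
Qed.

(* The difference of the two sides is
   [Var (int_0^oo g(X_s, s) ds) - Var (int_0^m g(X_s, s) ds)]. *)
Lemma truncated_variance_le (R : realType) (a1 a2 m : R) :
  0 < a1 -> 0 < a2 -> a2 <= 2 * a1 -> a2 != a1 -> 0 < m ->
  2 * (1 - expR (- (m * a2))) / (a1 * a2)
  + (2 * expR (- (m * a2)) - 2 * expR (- (m * a1))) / (a1 * (a2 - a1))
  - ((1 - expR (- (m * a1))) / a1) ^+ 2 <= 2 / (a1 * a2) - 1 / a1 ^+ 2.
Proof.
move=> a1_gt0 a2_gt0 a2_le a12 m0.
have a1_neq0 : a1 != 0 by rewrite gt_eqF.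
have a2_neq0 : a2 != 0 by rewrite gt_eqF.
have a21_neq0 : a2 - a1 != 0 by rewrite subr_eq0.
pose E1 := expR (- (m * a1)); pose E2 := expR (- (m * a2)).
have E1_gt0 : 0 < E1 by exact: expR_gt0.
have E21 : E1 * expR (- ((a2 - a1) * m)) = E2.
  by rewrite -expRD; congr expR; ring.
(* Divided by [a1], the gap is the covariance of the integrals over [0, m] and [m, +oo[. It is
   nonnegative because the rate a2 - a1 is at most a1. *)
have cross : E1 * ((1 - E1) / a1) <= (E1 - E2) / (a2 - a1).
  have a21_le : a2 - a1 <= a1 by lra.
  have := expRN_mean_value_le a21_neq0 a1_neq0 m0 a21_le.
  rewrite (mulrC a1 m) -(ler_pM2l E1_gt0) => /le_trans; apply.
  by rewrite mulrA mulrBr mulr1 E21.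
(* Multiplied by 2 / a1, the gap is the variance of the integral over [m, +oo[. *)
have tail : E1 ^+ 2 / (2 * a1) <= E2 / a2.
  apply: ler_pM; rewrite ?sqr_ge0 ?invr_ge0 ?mulr_ge0 ?(ltW a1_gt0)//.
    by rewrite -expRM_natl ler_expR; nra.
  by rewrite lef_pV2 ?posrE ?mulr_gt0.
rewrite -subr_ge0.
rewrite [X in 0 <= X](_ : _ = 2 / a1 * ((E2 / a2 - E1 ^+ 2 / (2 * a1)) +
  ((E1 - E2) / (a2 - a1) - E1 * ((1 - E1) / a1)))); last first.
  rewrite -/E1 -/E2; field.
  by rewrite a1_neq0 a2_neq0 a21_neq0.
by rewrite mulr_ge0 ?divr_ge0 ?(ltW a1_gt0)// addr_ge0 ?subr_ge0.
Qed.

(** The condition [a2 != a1] is implicit in [Delta4], which divides by [a2 - a1]: at equality that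
    fraction would be read as 0, whereas its limit is - 2 m exp (- m a1) / a1. *)
Theorem proposition2 (d : measure_display) (T : measurableType d)
    (R : realType) (P : probability T R) (Y : R -> {RV P >-> R})
    (phi : R -> \bar R) (c beta m : R)
    (hY : levy_process Y) (hphi : characteristic_exponent Y phi)
    (hc : 0 < c) (hm : 0 < m) :
  let X := fun (t : R) (w : T) => expR (Y t w) in
  let G := fun (t : R) (w : T) => discounted_power c beta (X t w) t in
  let phi1 : R -> \bar R := fun b => (phi b - c%:E)%E in
  let phi2 : R -> \bar R := fun b => (phi b - (2 * c)%:E)%E in
  let a1 : R := fine (`|phi1 beta|)%E in
  let a2 : R := fine (`|phi2 (2 * beta)%R|)%E in
  let Delta1 : R := expR (- (2 * a1 * m)) / a1 ^+ 2 in
  let Delta2 : R := 8 / m * (1 / (a1 * a2 ^+ 2)) - 1 / a1 ^+ 2 in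
  let Delta3 : R :=
    (2 + 2 * expR (- (m * a2) + 2)) / (a1 * a2) - 1 / a1 ^+ 2 in
  let Delta4 : R :=
    2 * (1 - expR (- (m * a2))) / (a1 * a2)
    + (2 * expR (- (m * a2)) - 2 * expR (- (m * a1))) / (a1 * (a2 - a1))
    - ((1 - expR (- (m * a1))) / a1) ^+ 2 in
  (phi1 beta < 0)%E -> (phi2 (2 * beta)%R < 0)%E ->
  a2 != a1 ->
  bias_variance_ratio P G m =
    (if m <= 2 / a2 then Delta1 / (Delta2 - Delta4)
     else Delta1 / (Delta3 - Delta4))%:E.
Proof.
move=> X G phi1 phi2 a1 a2 Delta1 Delta2 Delta3 Delta4 phi1_lt0 phi2_lt0 a12.
have phi_fin : phi beta \is a fin_num.
  apply: (exponent_fin_num hphi); move: phi1_lt0; rewrite /phi1.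
  by case: (phi beta) => [r||]//; rewrite ltry.
have phi2_fin : phi (2 * beta) \is a fin_num.
  apply: (exponent_fin_num hphi); move: phi2_lt0; rewrite /phi2.
  by case: (phi (2 * beta)) => [r||]//; rewrite ltry.
pose p := fine (phi beta); pose q := fine (phi (2 * beta)).
have [a1E a1_gt0] : a1 = c - p /\ 0 < a1.
  rewrite /a1 /phi1; move: phi1_lt0; rewrite /phi1 -(fineK phi_fin) -/p.
  by rewrite -EFinB lte_fin => pc; rewrite /= ltr0_norm// opprB; split => //; lra.
have [a2E a2_gt0] : a2 = 2 * c - q /\ 0 < a2.
  rewrite /a2 /phi2; move: phi2_lt0; rewrite /phi2 -(fineK phi2_fin) -/q.
  by rewrite -EFinB lte_fin => qc; rewrite /= ltr0_norm// opprB; split => //; lra.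
have GE t w : G t w = expR (- (c * t)) * expR (beta * Y t w).
  by rewrite /G /discounted_power /X -expRM (mulrC (Y t w)).
have G_ge0 t w : 0 <= G t w by rewrite GE mulr_ge0 ?expR_ge0.
have mexpY (b t : R) : measurable_fun setT (fun w => expR (b * Y t w)).
  by apply: measurableT_comp => //; exact: measurable_funM.
have mean_G t : 0 <= t -> (\int[P]_w (G t w)%:E = (expR (- (a1 * t)))%:E)%E.
  move=> t0; under eq_integral do rewrite GE EFinM.
  rewrite ge0_integralZl//; last exact/measurable_EFinP.
  rewrite (integral_exp_levy hphi)// -EFinM -expRD a1E.
  by congr (expR _)%:E; rewrite /p; ring.
have corr_G s t : 0 <= s -> s <= t ->
    (\int[P]_w (G s w * G t w)%:E =
     (expR (- (a2 * s)) * expR (- (a1 * (t - s))))%:E)%E.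
  move=> s0 st.
  transitivity (\int[P]_w ((expR (- (c * s)) * expR (- (c * t)))%:E *
      (expR (beta * Y s w) * expR (beta * Y t w))%:E))%E.
    by apply: eq_integral => w _; rewrite !GE mulrACA EFinM.
  rewrite ge0_integralZl//; last by apply/measurable_EFinP; exact: measurable_funM.
  rewrite (integral_exp_levy2 hY hphi)// -EFinM -!expRD a1E a2E.
  by congr (expR _)%:E; rewrite /p /q; ring.
have [A [mA A0 mY]] := levy_jointly_measurable hY.
have mG : measurable_fun (~` A `*` (`[0, +oo[%classic : set (measurableTypeR R)))
    (fun x : T * measurableTypeR R => G x.2 x.1).
  apply: (@eq_measurable_fun _ _ _ _ _
    (fun x => expR (- (c * x.2)) * expR (beta * Y x.2 x.1))).
    by move=> x _; rewrite GE.
  apply: measurable_funM.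
    apply: measurable_funTS.
    apply: (@measurableT_comp _ _ _ _ _ _ (fun t : R => expR (- (c * t))) _ snd).
      by apply: continuous_measurable_fun; exact: continuous_expRN.
    exact: measurable_snd.
  by apply: measurableT_comp => //; exact: measurable_funM.
(* The squared mean of g(X_1, 1) is at most its second moment, that is exp (- 2 a1) <= exp (-
   a2). *)
have a2_le : a2 <= 2 * a1.
  have mG1 : measurable_fun setT (G 1).
    rewrite (_ : G 1 = fun w => expR (- (c * 1)) * expR (beta * Y 1 w)).
      exact: measurable_funM.
    by apply/funext => w; rewrite GE.
  have := mean_square_bound mG1 (G_ge0 1) (mean_G 1 ler01)
    (corr_G 1 1 ler01 (lexx _)).
  by rewrite subrr !mulr1 mulr0 oppr0 expR0 mulr1 -expRM_natl ler_expR; lra.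
have [[Q0 [Q0_law mean_Q0] J_Q0] J_min] := optimal_weighted_tail a2_gt0 hm.
set J0 := (if _ then _ else _) in J_Q0 J_min.
have a1_neq0 : a1 != 0 by rewrite gt_eqF.
have a2_neq0 : a2 != 0 by rewrite gt_eqF.
have varE (Q : probability (measurableTypeR R) R) : truncation_laws Q ->
    ('V_(P \x Q)[randomized_integral G Q] =
    (2 / a1)%:E * \int[lebesgue_measure]_(s in `[0%R, +oo[)
      (expR (- (a2 * s)) / fine (Q `]s, +oo[%classic))%:E
    - (a1^-1 ^+ 2)%:E)%E.
  move=> [_ Q_gt0].
  exact: (randomized_integral_mean_variance mA A0 G_ge0 mG a1_gt0 mean_G
    corr_G Q_gt0).2.
have infE : ereal_inf [set 'V_(P \x Q)[randomized_integral G Q]%E |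
    Q in mean_constrained_laws m] = (2 / a1 * J0 - a1^-1 ^+ 2)%:E.
  apply/eqP; rewrite eq_le; apply/andP; split.
    apply: ereal_inf_lbound; exists Q0 => //.
    by rewrite varE// J_Q0 -EFinM -EFinB.
  apply: le_ereal_inf_tmp => _ [Q [hQ mean_Q] <-].
  rewrite varE// EFinB leeD// EFinM lee_wpmul2l//.
    by rewrite lee_fin divr_ge0 ?ltW.
  exact: J_min.
(* The bound 1 / a2 is the weighted integral for a survival function identically 1, that is without
   truncation. *)
have J0_gt : 1 / a2 < J0.
  rewrite /J0; case: ifPn => [m_le|_].
    rewrite (_ : 4 / (a2 ^+ 2 * m) = 1 / a2 * (4 / (m * a2))); last first.
      by field; rewrite a2_neq0 gt_eqF.
    rewrite ltr_pMr ?divr_gt0// ltr_pdivlMr ?mulr_gt0// mul1r.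
    by move: m_le; rewrite ler_pdivlMr// => /le_lt_trans; apply; rewrite ltr_nat.
  by rewrite ltr_pM2r ?invr_gt0// ltrDl expR_gt0.
(* A zero denominator would have an infinite inverse in the extended reals; this strict inequality
   makes the quotient an ordinary real one. *)
have D4_lt : Delta4 < 2 / a1 * J0 - a1^-1 ^+ 2.
  apply: (le_lt_trans (truncated_variance_le a1_gt0 a2_gt0 a2_le a12 hm)).
  rewrite (_ : 2 / (a1 * a2) - 1 / a1 ^+ 2 = 2 / a1 * (1 / a2) - a1^-1 ^+ 2).
    by rewrite ltrD2r ltr_pM2l ?divr_gt0.
  by field; rewrite a1_neq0 a2_neq0.
rewrite /bias_variance_ratio -/(mean_constrained_laws m).
rewrite (tail_integral_mean mA A0 G_ge0 mG a1_gt0 mean_G corr_G (ltW hm)).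
rewrite (truncated_integral_variance mA A0 G_ge0 mG a1_gt0 a2_gt0 mean_G corr_G
  a12 hm).
rewrite infE -EFinB -EFin_expe inver gt_eqF ?subr_gt0// -EFinM; congr _%:E.
rewrite (_ : (expR (- (a1 * m)) / a1) ^+ 2 = Delta1); last first.
  rewrite /Delta1 expr_div_n -expRM_natl; congr (expR _ / _); ring.
rewrite /J0; case: ifPn => _; congr (_ / (_ - _)).
- by rewrite /Delta2; field; rewrite a1_neq0 a2_neq0 gt_eqF.
- by rewrite /Delta3; field; rewrite a1_neq0 a2_neq0.
Qed.
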